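(* Let $c\ge1$. For a $c$-$\mathsf{Lie}$-central extension $\pi:\mathfrak g\twoheadrightarrow\mathfrak q$ of Leibniz algebras the following statements are equivalent: (a) $\pi:\mathfrak g\twoheadrightarrow\mathfrak q$ is a $c$-$\mathsf{Lie}$-stem cover. (b) $\mathfrak g/\gamma_{c+1}^{\mathsf{Lie}}(\mathfrak g)\cong\mathfrak q/\gamma_{c+1}^{\mathsf{Lie}}(\mathfrak q)$ and the induced map $\mathcal M_{\mathsf{Lie}}^{(c)}(\mathfrak g)\to\mathcal M_{\mathsf{Lie}}^{(c)}(\mathfrak q)$ is the zero map.
   Context: $\mathbb K$ is a field with $\frac12\in\mathbb K$. A Leibniz algebra is a $\mathbb K$-vector space with a bilinear bracket satisfying $[x,[y,z]]=[[x,y],z]-[[x,z],y]$. For two-sided ideals $\mathfrak m,\mathfrak n$ of $\mathfrak g$, $[\mathfrak m,\mathfrak n]_{\mathsf{Lie}}$ is the span of all $[m,n]+[n,m]$, $m\in\mathfrak m$, $n\in\mathfrak n$. For a two-sided ideal $\mathfrak n$: $\gamma_1^{\mathsf{Lie}}(\mathfrak g,\mathfrak n)=\mathfrak n$, $\gamma_i^{\mathsf{Lie}}(\mathfrak g,\mathfrak n)=[\gamma_{i-1}^{\mathsf{Lie}}(\mathfrak g,\mathfrak n),\mathfrak g]_{\mathsf{Lie}}$ for $i\ge2$, and $\gamma_i^{\mathsf{Lie}}(\mathfrak g)=\gamma_i^{\mathsf{Lie}}(\mathfrak g,\mathfrak g)$. A short exact sequence $0\to\mathfrak n\to\mathfrak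 g\xrightarrow{\pi}\mathfrak q\to0$ (equivalently, the surjection $\pi$ with kernel $\mathfrak n$) is a $c$-$\mathsf{Lie}$-central extension if $\gamma_{c+1}^{\mathsf{Lie}}(\mathfrak g,\mathfrak n)=0$; it is a $c$-$\mathsf{Lie}$-stem extension if moreover $\mathfrak n\subseteq\gamma_{c+1}^{\mathsf{Lie}}(\mathfrak g)$, and a $c$-$\mathsf{Lie}$-stem cover if in addition $\mathfrak n$ is isomorphic to $\mathcal M_{\mathsf{Lie}}^{(c)}(\mathfrak q)$. Let $0\to\mathfrak r\to\mathfrak f\xrightarrow{\rho}\mathfrak g\to0$ be a free presentation ($\mathfrak f$ a free Leibniz algebra) and $\mathfrak s=\ker(\pi\circ\rho)$. Then $\mathcal M_{\mathsf{Lie}}^{(c)}(\mathfrak g)=(\mathfrak r\cap\gamma_{c+1}^{\mathsf{Lie}}(\mathfrak f))/\gamma_{c+1}^{\mathsf{Lie}}(\mathfrak f,\mathfrak r)$, $\mathcal M_{\mathsf{Lie}}^{(c)}(\mathfrak q)=(\mathfrak s\cap\gamma_{c+1}^{\mathsf{Lie}}(\mathfrak f))/\gamma_{c+1}^{\mathsf{Lie}}(\mathfrak f,\mathfrak s)$, and the induced map between them comes from $\mathfrak r\subseteq\mathfrak s$.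
   Formalization: Both isomorphisms are required to be the canonical ones: M(q) ≅ n induced by ρ in (a), and g/γ_{c+1}(g) ≅ q/γ_{c+1}(q) induced by π in (b). With arbitrary isomorphisms the equivalence fails in infinite dimension; in finite dimension the readings agree. *)

(* Defs.v *)
From HB Require Import structures.
From mathcomp Require Import all_boot all_order all_algebra.
From mathcomp Require Import boolp.

Set Implicit Arguments.
Unset Strict Implicit.
Unset Printing Implicit Defensive.

Import GRing.Theory.
Local Open Scope ring_scope.
Local Open Scope quotient_scope.

(* Right Leibniz algebras: [x, [y, z]] = [[x, y], z] - [[x, z], y]. *)
HB.mixin Record Lmodule_isLeibniz (K : fieldType) L of GRing.Lmodule K L := {
  lbr : L -> L -> L;
  lbr_linearl : forall y, linear (lbr^~ y);
  lbr_linearr : forall x, linear (lbr x);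
  lbr_leibniz : forall x y z,
    lbr x (lbr y z) = lbr (lbr x y) z - lbr (lbr x z) y
}.

#[short(type="leibnizAlgType")]
HB.structure Definition LeibnizAlg (K : fieldType) :=
  {L of Lmodule_isLeibniz K L & GRing.Lmodule K L}.

HB.mixin Record isLeibnizMorphism (K : fieldType) (g q : leibnizAlgType K)
    (h : g -> q) := {
  lbr_morph : {morph h : x y / lbr x y >-> lbr x y}
}.

HB.structure Definition LeibnizHom (K : fieldType) (g q : leibnizAlgType K) :=
  {h of isLeibnizMorphism K g q h & @GRing.Linear K g q *:%R h}.

Notation "{ 'leibniz' g -> q }" := (LeibnizHom.type g q)
  (at level 0, g at level 98, q at level 99,
   format "{ 'leibniz'  g  ->  q }") : type_scope.

Section Bracket.
Variables (K : fieldType) (g : leibnizAlgType K).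
Implicit Types x y z : g.

Lemma lbrDl z : {morph (fun x => lbr x z) : x y / x + y}.
Proof. by move=> x y; have := lbr_linearl z 1 x y; rewrite !scale1r. Qed.

Lemma lbr0l z : lbr 0 z = 0.
Proof. by apply: (addIr (lbr 0 z)); rewrite -lbrDl !add0r. Qed.

Lemma lbrZl z a x : lbr (a *: x) z = a *: lbr x z.
Proof. by rewrite -[a *: x]addr0 (lbr_linearl z a x 0) lbr0l addr0. Qed.

Lemma lbrNl z x : lbr (- x) z = - lbr x z.
Proof. by rewrite -scaleN1r lbrZl scaleN1r. Qed.

Lemma lbrBl z x y : lbr (x - y) z = lbr x z - lbr y z.
Proof. by rewrite lbrDl lbrNl. Qed.

Lemma lbrDr z : {morph lbr z : x y / x + y}.
Proof. by move=> x y; have := lbr_linearr z 1 x y; rewrite !scale1r. Qed.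

Lemma lbr0r z : lbr z 0 = 0.
Proof. by apply: (addIr (lbr z 0)); rewrite -lbrDr !add0r. Qed.

Lemma lbrZr z a x : lbr z (a *: x) = a *: lbr z x.
Proof. by rewrite -[a *: x]addr0 (lbr_linearr z a x 0) lbr0r addr0. Qed.

Lemma lbrNr z x : lbr z (- x) = - lbr z x.
Proof. by rewrite -scaleN1r lbrZr scaleN1r. Qed.

Lemma lbrBr z x y : lbr z (x - y) = lbr z x - lbr z y.
Proof. by rewrite lbrDr lbrNr. Qed.

Lemma lbr_suml z n (F : 'I_n -> g) :
  lbr (\sum_i F i) z = \sum_i lbr (F i) z.
Proof. exact: (big_morph (fun x => lbr x z) (lbrDl z) (lbr0l z)). Qed.

Lemma lbr_sumr z n (F : 'I_n -> g) :
  lbr z (\sum_i F i) = \sum_i lbr z (F i).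
Proof. exact: (big_morph (lbr z) (lbrDr z) (lbr0r z)). Qed.

End Bracket.

Section CompHom.
Variables (K : fieldType) (f g q : leibnizAlgType K).
Variables (p : {leibniz g -> q}) (r : {leibniz f -> g}).

Fact comp_lbr_morph : {morph p \o r : x y / lbr x y >-> lbr x y}.
Proof. by move=> x y /=; rewrite !lbr_morph. Qed.

HB.instance Definition _ :=
  isLeibnizMorphism.Build K f q (p \o r) comp_lbr_morph.

End CompHom.

Record ideal (K : fieldType) (g : leibnizAlgType K) := Ideal {
  ideal_pred :> {pred g};
  ideal_submod : submod_closed ideal_pred;
  ideal_lbrl : forall x y, x \in ideal_pred -> lbr x y \in ideal_pred;
  ideal_lbrr : forall x y, x \in ideal_pred -> lbr y x \in ideal_pred
}.

HB.instance Definition _ (K : fieldType) (g : leibnizAlgType K) (I : ideal g) :=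
  GRing.isSubmodClosed.Build K g (ideal_pred I)
    (GRing.submod_closed_semi (ideal_submod I)).

Section Ideals.
Variables (K : fieldType) (g : leibnizAlgType K).
Implicit Types (I J : ideal g).

Definition full_ideal : ideal g.
Proof. by exists predT. Defined.

Definition cap_ideal I J : ideal g.
Proof.
exists [pred x | (x \in I) && (x \in J)].
- split=> [|a x y]; rewrite !inE ?rpred0 //.
  by move=> /andP[xI xJ] /andP[yI yJ]; rewrite !rpredD ?rpredZ.
- by move=> x y; rewrite !inE => /andP[xI xJ]; rewrite !ideal_lbrl.
- by move=> x y; rewrite !inE => /andP[xI xJ]; rewrite !ideal_lbrr.
Defined.

(* {v | v is a K-linear combination of elements of A} *)
Definition lspan (A : g -> Prop) : {pred g} :=
  fun v => `[< exists n (a : 'I_n -> K) (u : 'I_n -> g),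
                 (forall i, A (u i)) /\ v = \sum_(i < n) a i *: u i >].

Lemma lspan_gen (A : g -> Prop) u : A u -> u \in lspan A.
Proof.
move=> Au; apply/asboolP; exists 1%N, (fun=> 1), (fun=> u); split=> //.
by rewrite big_ord1 scale1r.
Qed.

Lemma lspan_submod (A : g -> Prop) : submod_closed (lspan A).
Proof.
split=> [|a x y].
  apply/asboolP; exists 0%N, (fun=> 0), (fun=> 0); split; first by case.
  by rewrite big_ord0.
move=> /asboolP[n [b [u [Au ->]]]] /asboolP[m [d [v [Av ->]]]].
apply/asboolP; exists (n + m)%N,
  (fun i => match split i with inl j => a * b j | inr j => d j end),
  (fun i => match split i with inl j => u j | inr j => v j end).
split=> [i|]; first by case: (split i).
rewrite big_split_ord /= scaler_sumr; congr (_ + _); apply: eq_bigr => i _.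
  by rewrite (unsplitK (inl i)) scalerA.
by rewrite (unsplitK (inr i)).
Qed.

Lemma lspan_min (A : g -> Prop) (S : {pred g}) : submod_closed S ->
  (forall u, A u -> u \in S) -> {subset lspan A <= S}.
Proof.
move=> [S0 Slin] AS x /asboolP[n [b [u [Au ->]]]].
elim/big_rec: _ => [|i y _ yS]; first exact: S0.
by apply: Slin => //; apply: AS.
Qed.

Definition lie_comm_gen I J (z : g) : Prop :=
  exists m n, [/\ m \in I, n \in J & z = lbr m n + lbr n m].

Lemma lbr_sym0 (x m n : g) : lbr x (lbr m n + lbr n m) = 0.
Proof. by rewrite lbrDr !lbr_leibniz addrA subrK subrr. Qed.

Lemma lbr_sym (x m n : g) : lbr (lbr m n + lbr n m) x =
  (lbr (lbr m x) n + lbr n (lbr m x)) + (lbr m (lbr n x) + lbr (lbr n x) m).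
Proof.
by rewrite !lbr_leibniz lbrDl addrACA subrK [_ + (_ - _)]addrC subrK.
Qed.

(* The Lie-commutator ideal [I, J]_Lie. *)
Definition lie_comm I J : ideal g.
Proof.
exists (lspan (lie_comm_gen I J)); first exact: lspan_submod.
- move=> x y /asboolP[n [b [u [Au ->]]]].
  rewrite lbr_suml; have [S0 Slin] := lspan_submod (lie_comm_gen I J).
  elim/big_rec: _ => [|i z _ zS]; first exact: S0.
  rewrite lbrZl; apply: (Slin) => //; have [m [k [mI kJ ->]]] := Au i.
  rewrite lbr_sym -[X in X + _]scale1r; apply: (Slin); apply: lspan_gen.
    by exists (lbr m y), k; rewrite ideal_lbrl.
  by exists m, (lbr k y); rewrite ideal_lbrl.
- move=> x y /asboolP[n [b [u [Au ->]]]].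
  rewrite lbr_sumr; have [S0 Slin] := lspan_submod (lie_comm_gen I J).
  elim/big_rec: _ => [|i z _ zS]; first exact: S0.
  rewrite lbrZr; apply: (Slin) => //; have [m [k [mI kJ ->]]] := Au i.
  by rewrite lbr_sym0.
Defined.

(* lie_gamma N i is gamma_i^Lie(g, N) for i >= 1 (lie_gamma N 0 is a dummy
   value, equal to N). *)
Definition lie_gamma (N : ideal g) (i : nat) : ideal g :=
  iter i.-1 (fun M => lie_comm M full_ideal) N.

Lemma lie_commS I I' J J' : {subset I <= I'} -> {subset J <= J'} ->
  {subset lie_comm I J <= lie_comm I' J'}.
Proof.
move=> sI sJ; apply: lspan_min; first exact: lspan_submod.
move=> u [m [n [mI nJ ->]]]; apply: lspan_gen; exists m, n.
by split; [exact: sI|exact: sJ|].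
Qed.

Lemma lie_gammaS I J i : {subset I <= J} ->
  {subset lie_gamma I i <= lie_gamma J i}.
Proof.
by move=> sIJ; rewrite /lie_gamma; elim: i.-1 => //= k IH; apply: lie_commS.
Qed.

End Ideals.

Arguments full_ideal {K} g.

Section Kernel.
Variables (K : fieldType) (g q : leibnizAlgType K) (h : {leibniz g -> q}).

Definition ker_ideal : ideal g.
Proof.
exists [pred x | h x == 0].
- split=> [|a x y]; rewrite !inE ?linear0 //.
  by move=> /eqP hx /eqP hy; rewrite linearP /= hx hy scaler0 addr0.
- by move=> x y; rewrite !inE lbr_morph => /eqP->; rewrite lbr0l.
- by move=> x y; rewrite !inE lbr_morph => /eqP->; rewrite lbr0r.
Defined.

End Kernel.

(* An ideal, viewed as a Leibniz algebra in its own right. *)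
Section SubAlgebra.
Variables (K : fieldType) (g : leibnizAlgType K) (I : ideal g).

Definition sub_alg : Type := {x : g | x \in I}.
HB.instance Definition _ := SubChoice.on sub_alg.
HB.instance Definition _ := [SubChoice_isSubLmodule of sub_alg by <:].

Definition sub_lbr (x y : sub_alg) : sub_alg :=
  Sub (lbr (val x) (val y)) (ideal_lbrl (val y) (valP x)).

Fact sub_lbr_linearl y : linear (sub_lbr^~ y).
Proof.
by move=> a u v; apply: val_inj; rewrite /= lbrDl lbrZl.
Qed.

Fact sub_lbr_linearr x : linear (sub_lbr x).
Proof.
by move=> a u v; apply: val_inj; rewrite /= lbrDr lbrZr.
Qed.

Fact sub_lbr_leibniz x y z : sub_lbr x (sub_lbr y z) =
  sub_lbr (sub_lbr x y) z - sub_lbr (sub_lbr x z) y.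
Proof. by apply: val_inj; rewrite /= lbr_leibniz. Qed.

HB.instance Definition _ := Lmodule_isLeibniz.Build K sub_alg
  sub_lbr_linearl sub_lbr_linearr sub_lbr_leibniz.

(* J, restricted to the subalgebra I *)
Definition sub_ideal (J : ideal g) : ideal sub_alg.
Proof.
exists [pred x : sub_alg | val x \in J].
- split=> [|a x y]; rewrite !inE /= ?rpred0 //.
  by move=> xJ yJ; rewrite rpredD ?rpredZ.
- by move=> x y; rewrite !inE /= => xJ; rewrite ideal_lbrl.
- by move=> x y; rewrite !inE /= => xJ; rewrite ideal_lbrr.
Defined.

End SubAlgebra.

Section SubInclusion.
Variables (K : fieldType) (g : leibnizAlgType K) (I J : ideal g).
Hypothesis sIJ : {subset I <= J}.

Definition sub_incl (x : sub_alg I) : sub_alg J := Sub (val x) (sIJ (valP x)).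

Fact sub_incl_linear : linear sub_incl.
Proof. by move=> a x y; apply: val_inj. Qed.

Fact sub_incl_lbr : {morph sub_incl : x y / lbr x y >-> lbr x y}.
Proof. by move=> x y; apply: val_inj. Qed.

HB.instance Definition _ := GRing.isLinear.Build K (sub_alg I) (sub_alg J) _
  sub_incl sub_incl_linear.
HB.instance Definition _ := isLeibnizMorphism.Build K (sub_alg I) (sub_alg J)
  sub_incl sub_incl_lbr.

End SubInclusion.

Section Quotient.
Variables (K : fieldType) (g : leibnizAlgType K) (I : ideal g).

Definition quot_alg : Type := {ideal_quot (ideal_pred I : zmodClosed g)}.
HB.instance Definition _ := GRing.Zmodule.on quot_alg.

Definition qpi (x : g) : quot_alg := \pi_{ideal_quot (ideal_pred I : zmodClosed g)} x.
Definition qrepr (x : quot_alg) : g :=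
  repr (x : {ideal_quot (ideal_pred I : zmodClosed g)}).

Lemma qreprK : cancel qrepr qpi.
Proof. exact: reprK. Qed.

Lemma qpi_eq x y : (qpi x == qpi y) = (x - y \in I).
Proof. by rewrite /qpi -Quotient.idealrBE. Qed.

Lemma qpi_eq0 x : (qpi x == 0) = (x \in I).
Proof. by rewrite -[x in RHS]subr0 -qpi_eq /qpi raddf0. Qed.

Lemma qpiD : {morph qpi : x y / x + y}.
Proof. exact: raddfD. Qed.

Definition qscale (a : K) (x : quot_alg) : quot_alg := qpi (a *: qrepr x).

Lemma qscaleE a x : qscale a (qpi x) = qpi (a *: x).
Proof. by apply/eqP; rewrite qpi_eq -scalerBr rpredZ // -qpi_eq qreprK. Qed.

Fact qscaleA a b v : qscale a (qscale b v) = qscale (a * b) v.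
Proof. by rewrite -[v]qreprK !qscaleE scalerA. Qed.

Fact qscale1 : left_id 1 qscale.
Proof. by move=> v; rewrite -[v]qreprK !qscaleE scale1r. Qed.

Fact qscaleDr : right_distributive qscale +%R.
Proof.
move=> a u v; rewrite -[u]qreprK -[v]qreprK -qpiD !qscaleE -qpiD.
by rewrite scalerDr.
Qed.

Fact qscaleDl v : {morph qscale^~ v : a b / a + b}.
Proof.
by move=> a b; rewrite -[v]qreprK !qscaleE -qpiD scalerDl.
Qed.

HB.instance Definition _ := GRing.Zmodule_isLmodule.Build K quot_alg
  qscaleA qscale1 qscaleDr qscaleDl.

Fact qpi_linear : linear qpi.
Proof. by move=> a x y; rewrite qpiD; congr (_ + _); rewrite -qscaleE. Qed.

HB.instance Definition _ := GRing.isLinear.Build K g quot_alg _ qpi qpi_linear.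

Definition qlbr (x y : quot_alg) : quot_alg := qpi (lbr (qrepr x) (qrepr y)).

Lemma qlbrE x y : qlbr (qpi x) (qpi y) = qpi (lbr x y).
Proof.
have H z : qrepr (qpi z) - z \in I by rewrite -qpi_eq qreprK.
apply/eqP; rewrite qpi_eq.
set a := qrepr (qpi x); set b := qrepr (qpi y).
have -> : lbr a b - lbr x y = lbr (a - x) b + lbr x (b - y).
  by rewrite lbrBl lbrBr addrA subrK.
by apply: rpredD; [apply: ideal_lbrl; apply: H|apply: ideal_lbrr; apply: H].
Qed.

Fact qlbr_linearl y : linear (qlbr^~ y).
Proof.
move=> a u v; rewrite -[y]qreprK -[u]qreprK -[v]qreprK -linearP !qlbrE -linearP.
by rewrite lbrDl lbrZl.
Qed.

Fact qlbr_linearr x : linear (qlbr x).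
Proof.
move=> a u v; rewrite -[x]qreprK -[u]qreprK -[v]qreprK -linearP !qlbrE -linearP.
by rewrite lbrDr lbrZr.
Qed.

Fact qlbr_leibniz x y z :
  qlbr x (qlbr y z) = qlbr (qlbr x y) z - qlbr (qlbr x z) y.
Proof.
rewrite -[x]qreprK -[y]qreprK -[z]qreprK !qlbrE -linearB.
by rewrite lbr_leibniz.
Qed.

HB.instance Definition _ := Lmodule_isLeibniz.Build K quot_alg
  qlbr_linearl qlbr_linearr qlbr_leibniz.

Fact qpi_lbr : {morph qpi : x y / lbr x y >-> lbr x y}.
Proof. by move=> x y; rewrite -qlbrE. Qed.

HB.instance Definition _ := isLeibnizMorphism.Build K g quot_alg qpi qpi_lbr.

End Quotient.

Section QuotientMap.
Variables (K : fieldType) (g g' : leibnizAlgType K) (h : {leibniz g -> g'}).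
Variables (I : ideal g) (J : ideal g').
Definition quot_map of (forall x, x \in I -> h x \in J) :
  quot_alg I -> quot_alg J := fun y => qpi J (h (qrepr y)).

Hypothesis hIJ : forall x, x \in I -> h x \in J.

Lemma quot_mapE x : quot_map hIJ (qpi I x) = qpi J (h x).
Proof. by apply/eqP; rewrite qpi_eq -linearB hIJ // -qpi_eq qreprK. Qed.

Fact quot_map_linear : linear (quot_map hIJ).
Proof.
by move=> a x y; rewrite -[x]qreprK -[y]qreprK -linearP !quot_mapE -!linearP.
Qed.

Fact quot_map_lbr : {morph quot_map hIJ : x y / lbr x y >-> lbr x y}.
Proof.
by move=> x y; rewrite -[x]qreprK -[y]qreprK -lbr_morph !quot_mapE -!lbr_morph.
Qed.

HB.instance Definition _ := GRing.isLinear.Build K (quot_alg I) (quot_alg J) _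
  (quot_map hIJ) quot_map_linear.
HB.instance Definition _ := isLeibnizMorphism.Build K (quot_alg I) (quot_alg J)
  (quot_map hIJ) quot_map_lbr.

End QuotientMap.

Definition is_free (K : fieldType) (f : leibnizAlgType K) : Prop :=
  exists (X : Type) (i : X -> f),
    forall (L : leibnizAlgType K) (t : X -> L),
      exists2 phi : {leibniz f -> L},
        (forall x, phi (i x) = t x) &
        (forall psi : {leibniz f -> L},
           (forall x, psi (i x) = t x) -> psi =1 phi).

Definition surj (T U : Type) (h : T -> U) : Prop := forall y, exists x, h x = y.

Definition free_presentation (K : fieldType) (f g : leibnizAlgType K)
    (rho : {leibniz f -> g}) : Prop :=
  is_free f /\ surj rho.

(* For a free presentation rho : f ->> g with kernel r, lie_multiplier c rho is
   M_Lie^(c)(g) = (r :&: gamma_(c+1)^Lie(f)) / gamma_(c+1)^Lie(f, r). *)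
Section Multiplier.
Variables (K : fieldType) (c : nat) (f g : leibnizAlgType K).
Variable rho : {leibniz f -> g}.

Definition mult_num : ideal f :=
  cap_ideal (ker_ideal rho) (lie_gamma (full_ideal f) c.+1).

Definition mult_den : ideal f := lie_gamma (ker_ideal rho) c.+1.

Lemma mult_den_sub : {subset mult_den <= mult_num}.
Proof.
have sk : {subset mult_den <= ker_ideal rho}.
  rewrite /mult_den /lie_gamma -[c.+1.-1]/c; elim: c => [//|k IH].
  apply: lspan_min; first exact: (ideal_submod (ker_ideal rho)).
  move=> u [m [n [/IH mk _ ->]]].
  by have := rpredD (ideal_lbrl n mk) (ideal_lbrr n mk).
move=> x xd; rewrite !inE; apply/andP; split; first exact: sk.
exact: (lie_gammaS (J := full_ideal f)) xd.
Qed.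

Definition lie_multiplier : leibnizAlgType K :=
  quot_alg (sub_ideal mult_num mult_den).

Definition mult_class : {leibniz sub_alg mult_num -> lie_multiplier} :=
  qpi (sub_ideal mult_num mult_den).

End Multiplier.

(* The map M_Lie^(c)(g) -> M_Lie^(c)(q) induced by p : g -> q, the multipliers
   being computed from the presentations rho of g and p \o rho of q. *)
Section InducedMap.
Variables (K : fieldType) (c : nat) (f g q : leibnizAlgType K).
Variables (p : {leibniz g -> q}) (rho : {leibniz f -> g}).

Lemma ker_comp_sub : {subset ker_ideal rho <= ker_ideal (p \o rho)}.
Proof. by move=> x; rewrite !inE /= => /eqP->; rewrite linear0. Qed.

Lemma mult_num_sub : {subset mult_num c rho <= mult_num c (p \o rho)}.
Proof.
move=> x; rewrite !inE => /andP[xr xg]; apply/andP; split=> //.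
exact: ker_comp_sub xr.
Qed.

Lemma mult_den_incl (x : sub_alg (mult_num c rho)) :
  x \in sub_ideal (mult_num c rho) (mult_den c rho) ->
  sub_incl mult_num_sub x \in
    sub_ideal (mult_num c (p \o rho)) (mult_den c (p \o rho)).
Proof. rewrite !inE /=; exact/lie_gammaS/ker_comp_sub. Qed.

Definition mult_induced :
    {leibniz lie_multiplier c rho -> lie_multiplier c (p \o rho)} :=
  quot_map mult_den_incl.

End InducedMap.

Section Extensions.
Variables (K : fieldType) (c : nat) (f g q : leibnizAlgType K).
Variables (p : {leibniz g -> q}) (rho : {leibniz f -> g}).

Definition lie_central_ext : Prop :=
  surj p /\ (forall x, x \in lie_gamma (ker_ideal p) c.+1 -> x = 0).

Definition lie_stem_ext : Prop :=
  lie_central_ext /\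
  {subset ker_ideal p <= lie_gamma (full_ideal g) c.+1}.

(* The isomorphism M_Lie^(c)(q) ~ n is the one of the exact sequence
   M(g) -> M(q) -> n -> g / gamma_(c+1)(g) -> q / gamma_(c+1)(q) -> 0, i.e. the
   one given by rho on s :&: gamma_(c+1)(f).  In infinite dimension the mere
   existence of some isomorphism is a strictly weaker condition. *)
Definition multiplier_iso_ker : Prop :=
  exists2 theta : {leibniz lie_multiplier c (p \o rho) ->
                           sub_alg (ker_ideal p)},
    bijective theta &
    forall x : sub_alg (mult_num c (p \o rho)),
      val (theta (mult_class c (p \o rho) x)) = rho (val x).

Definition lie_stem_cover : Prop := lie_stem_ext /\ multiplier_iso_ker.

(* g / gamma_(c+1)(g) ~ q / gamma_(c+1)(q), by the isomorphism that p induces *)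
Definition lie_quot_iso : Prop :=
  exists2 phi : {leibniz quot_alg (lie_gamma (full_ideal g) c.+1) ->
                         quot_alg (lie_gamma (full_ideal q) c.+1)},
    bijective phi & forall x : g, phi (qpi _ x) = qpi _ (p x).

End Extensions.

(* Main.v *)
(** Let [r] and [s] be the kernels of [rho] and [p \o rho], [n] that of [p].
    As [rho] is onto, it maps [gamma_(c+1)(f)] onto [gamma_(c+1)(g)] and
    [gamma_(c+1)(f, s)] into [gamma_(c+1)(g, n) = 0], hence it induces a map
    [M(q) -> n] with image [n :&: gamma_(c+1)(g)], whose kernel consists of the
    classes of [r :&: gamma_(c+1)(f)], i.e. is the image of [M(g) -> M(q)].
    So this map is injective iff the induced map vanishes, and it is onto iff
    [n] lies in [gamma_(c+1)(g)], which is also the condition for [p] to induce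
    an isomorphism of the quotients by [gamma_(c+1)]. *)
Require Import Defs.
From HB Require Import structures.
From mathcomp Require Import all_boot all_order all_algebra.
From mathcomp Require Import boolp.

Set Implicit Arguments.
Unset Strict Implicit.
Unset Printing Implicit Defensive.

Import GRing.Theory.
Local Open Scope ring_scope.

(** [bijective] asks for an actual inverse function; choice extracts it from surjectivity. *)
Lemma inj_surj_bij (T U : Type) (h : T -> U) :
  injective h -> surj h -> bijective h.
Proof.
by move=> hI /choice[k kK]; exists k => // x; apply: hI; rewrite kK.
Qed.

Section RestrictedHom.
Variables (K : fieldType) (g g' : leibnizAlgType K) (h : {leibniz g -> g'}).
Variables (I : ideal g) (J : ideal g').

Hypothesis hIJ : forall x, x \in I -> h x \in J.

Definition sub_hom (x : sub_alg I) : sub_alg J :=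
  Sub (h (val x)) (hIJ (valP x)).

Fact sub_hom_linear : linear sub_hom.
Proof. by move=> a x y; apply: val_inj; rewrite /= linearP. Qed.

Fact sub_hom_lbr : {morph sub_hom : x y / lbr x y >-> lbr x y}.
Proof. by move=> x y; apply: val_inj; rewrite /= lbr_morph. Qed.

HB.instance Definition _ := GRing.isLinear.Build K (sub_alg I) (sub_alg J) _
  sub_hom sub_hom_linear.
HB.instance Definition _ := isLeibnizMorphism.Build K (sub_alg I) (sub_alg J)
  sub_hom sub_hom_lbr.

End RestrictedHom.

Section FactorHom.
Variables (K : fieldType) (g g' : leibnizAlgType K) (h : {leibniz g -> g'}).
Variable I : ideal g.

Hypothesis hI0 : forall x, x \in I -> h x = 0.

(** The proof is an explicit argument so that the linear and Leibniz structures, which depend on it,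
    can be attached to [quot_factor hI0]. *)
Definition quot_factor of (forall x, x \in I -> h x = 0) :
  quot_alg I -> g' := fun y => h (qrepr y).

Lemma quot_factorE x : quot_factor hI0 (qpi I x) = h x.
Proof.
apply/eqP; rewrite -subr_eq0 -linearB /=.
by apply/eqP/hI0; rewrite -qpi_eq qreprK.
Qed.

Fact quot_factor_linear : linear (quot_factor hI0).
Proof.
by move=> a x y; rewrite -[x]qreprK -[y]qreprK -linearP !quot_factorE linearP.
Qed.

Fact quot_factor_lbr : {morph quot_factor hI0 : x y / lbr x y >-> lbr x y}.
Proof.
move=> x y; rewrite -[x]qreprK -[y]qreprK -lbr_morph !quot_factorE.
exact: lbr_morph.
Qed.

HB.instance Definition _ := GRing.isLinear.Build K (quot_alg I) g' _
  (quot_factor hI0) quot_factor_linear.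
HB.instance Definition _ := isLeibnizMorphism.Build K (quot_alg I) g'
  (quot_factor hI0) quot_factor_lbr.

End FactorHom.

Section LieGammaHom.
Variables (K : fieldType) (g g' : leibnizAlgType K) (h : {leibniz g -> g'}).

Lemma lie_comm_hom (I J : ideal g) (I' J' : ideal g') :
    (forall x, x \in I -> h x \in I') -> (forall x, x \in J -> h x \in J') ->
  forall x, x \in lie_comm I J -> h x \in lie_comm I' J'.
Proof.
move=> hI hJ x /asboolP[n [a [u [Au ->]]]].
rewrite linear_sum rpred_sum // => i _; rewrite linearZ rpredZ //.
have [v [w [vI wJ ->]]] := Au i; apply: lspan_gen; exists (h v), (h w).
by rewrite hI ?hJ // linearD /= !lbr_morph.
Qed.

(** A generator lifts once its two entries are lifted separately; linearity extends this to the
    span. *)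
Lemma lie_comm_lift (I J : ideal g) (I' J' : ideal g') :
    (forall y, y \in I' -> exists2 x, x \in I & h x = y) ->
    (forall y, y \in J' -> exists2 x, x \in J & h x = y) ->
  forall y, y \in lie_comm I' J' -> exists2 x, x \in lie_comm I J & h x = y.
Proof.
move=> hI hJ y /asboolP[n [a [u [Au ->]]]].
elim/big_rec: _ => [|i _ _ [x xIJ <-]]; first by exists 0; rewrite ?rpred0 ?linear0.
have [_ [_ [/hI[v vI <-] /hJ[w wJ <-] ->]]] := Au i.
exists (a i *: (lbr v w + lbr w v) + x); last first.
  by rewrite linearP /= linearD /= !lbr_morph.
by rewrite rpredD ?rpredZ //; apply: lspan_gen; exists v, w.
Qed.

Lemma lie_gamma_hom (I : ideal g) (I' : ideal g') k :
    (forall x, x \in I -> h x \in I') ->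
  forall x, x \in lie_gamma I k -> h x \in lie_gamma I' k.
Proof.
rewrite /lie_gamma => hI; elim: k.-1 => //= m IH.
exact: lie_comm_hom.
Qed.

Lemma lie_gamma_lift (I : ideal g) (I' : ideal g') k : surj h ->
    (forall y, y \in I' -> exists2 x, x \in I & h x = y) ->
  forall y, y \in lie_gamma I' k -> exists2 x, x \in lie_gamma I k & h x = y.
Proof.
rewrite /lie_gamma => hS hI; elim: k.-1 => //= m IH.
(* The second entry ranges over the whole of [g'], hence the need for [h] to be onto. *)
by apply: lie_comm_lift => // y _; have [x] := hS y; exists x.
Qed.

Lemma lie_gamma_full_lift k : surj h ->
  forall y, y \in lie_gamma (full_ideal g') k ->
  exists2 x, x \in lie_gamma (full_ideal g) k & h x = y.
Proof.
by move=> hS; apply: lie_gamma_lift => // y _; have [x] := hS y; exists x.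
Qed.

End LieGammaHom.

Lemma mem_ker (K : fieldType) (g q : leibnizAlgType K) (h : {leibniz g -> q})
  x : (x \in ker_ideal h) = (h x == 0).
Proof. by []. Qed.

Lemma lie_quot_isoP (K : fieldType) (c : nat) (g q : leibnizAlgType K)
    (p : {leibniz g -> q}) : surj p ->
  lie_quot_iso c p <-> {subset ker_ideal p <= lie_gamma (full_ideal g) c.+1}.
Proof.
move=> pS; split=> [[phi /bij_inj phiI phiE] x | sub].
  rewrite mem_ker -qpi_eq0 => /eqP px0; apply/eqP/phiI.
  by rewrite phiE px0 !linear0.
have pG x : x \in lie_gamma (full_ideal g) c.+1 ->
            p x \in lie_gamma (full_ideal q) c.+1 by exact: lie_gamma_hom.
exists (quot_map pG : {leibniz _ -> _}); last exact: quot_mapE.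
apply: inj_surj_bij => [|y]; last first.
  have [x px] := pS (qrepr y); exists (qpi _ x).
  by rewrite /= quot_mapE px qreprK.
apply: raddf_inj => y; rewrite -[y]qreprK /= quot_mapE.
(* The representative and [z] have the same image under [p], so they differ by an element of the
   kernel, which [sub] places in the same term of the series as [z]. *)
move/eqP; rewrite qpi_eq0 => /(lie_gamma_full_lift pS)[z zG pz].
apply/eqP; rewrite qpi_eq0 -(subrK z (qrepr y)) rpredD // sub //.
by rewrite mem_ker linearB /= pz subrr.
Qed.

Section MultiplierKernel.
Variables (K : fieldType) (c : nat) (f g q : leibnizAlgType K).
Variables (p : {leibniz g -> q}) (rho : {leibniz f -> g}).

Lemma mult_inducedE (x : sub_alg (mult_num c rho)) :
  mult_induced c p rho (mult_class c rho x) =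
  mult_class c (p \o rho) (sub_incl (@mult_num_sub _ c _ _ _ p rho) x).
Proof. exact: quot_mapE. Qed.

Lemma multiplier_iso_kerP : surj rho -> lie_central_ext c p ->
    {subset ker_ideal p <= lie_gamma (full_ideal g) c.+1} ->
  multiplier_iso_ker c p rho <->
  (forall x : lie_multiplier c rho, mult_induced c p rho x = 0).
Proof.
move=> rhoS [_ pC] stem; split=> [[theta /bij_inj thetaI thetaE] y|ind0].
  rewrite -[y]qreprK mult_inducedE; set x := qrepr y.
  (* [theta] acts as [rho] on representatives, and [x] comes from the kernel of [rho]. *)
  apply: thetaI; apply: val_inj; rewrite thetaE !linear0 /=.
  by have /andP[/eqP] := valP x.
have numK x : x \in mult_num c (p \o rho) -> rho x \in ker_ideal p.
  by case/andP.
have den0 x : x \in sub_ideal (mult_num c (p \o rho)) (mult_den c (p \o rho)) ->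
              sub_hom numK x = 0.
  (* [rho] sends the denominator into [lie_gamma (ker_ideal p) c.+1], which is zero by
     centrality. *)
  move=> xd; apply/val_inj/pC.
  by apply: lie_gamma_hom xd => z.
pose theta : {leibniz lie_multiplier c (p \o rho) -> sub_alg (ker_ideal p)} :=
  quot_factor (h := sub_hom numK) den0.
have thetaE x : theta (mult_class c (p \o rho) x) = sub_hom numK x.
  exact: quot_factorE.
exists theta; last by move=> x; rewrite thetaE.
apply: inj_surj_bij => [|y].
  apply: raddf_inj => y; rewrite -[y]qreprK; set x := qrepr y.
  move/(etrans (esym (thetaE x)))/(congr1 val) => /= rx0.
  have /andP[_ xG] := valP x.
  (* Since [rho] kills [x], the class of [x] already comes from the multiplier of [g], where [ind0]
     applies. *)
  have xn : val x \in mult_num c rho by apply/andP; split; first exact/eqP.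
  have := ind0 (mult_class c rho (Sub (val x) xn)); rewrite mult_inducedE => <-.
  by congr (qpi _ _); apply: val_inj.
(* Surjectivity is where the stem inclusion enters: it lets [y] be lifted inside the series of
   [f]. *)
have [x xG rx] := lie_gamma_full_lift rhoS (stem _ (valP y)).
have xn : x \in mult_num c (p \o rho).
  by apply/andP; split=> //; rewrite mem_ker /= rx; exact: (valP y).
by exists (mult_class c (p \o rho) (Sub x xn)); rewrite thetaE; apply: val_inj.
Qed.

End MultiplierKernel.

Theorem proposition5p3 (K : fieldType) (hK : (2%:R : K) != 0)
    (c : nat) (hc : (1 <= c)%N) (f g q : leibnizAlgType K)
    (p : {leibniz g -> q}) (rho : {leibniz f -> g})
    (hrho : free_presentation rho) (hp : lie_central_ext c p) :
  lie_stem_cover c p rho <->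
  (lie_quot_iso c p /\
   forall x : lie_multiplier c rho, mult_induced c p rho x = 0).
Proof.
have [pS _] := hp; have [_ rhoS] := hrho; split.
  move=> [[_ stem] iso]; split; first exact/lie_quot_isoP.
  exact/multiplier_iso_kerP.
(* The stem inclusion must be obtained first, as the criterion for the multiplier assumes it. *)
move=> [/(lie_quot_isoP c pS) stem ind0]; split; first by [].
exact/multiplier_iso_kerP.
Qed.
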